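(* Point-hyperplane projective geometry of $\mathbb{RP}^n$ is locally isomorphic to the hyperbolic geometry $\mathbb H^n_{\mathbb R\oplus\mathbb R}$ over $\mathbb R\oplus\mathbb R$.
   Context: $\mathbb R\oplus\mathbb R$ is regarded as the algebra $\{a+\lambda b:a,b\in\mathbb R\}$, $\lambda^2=1$, with conjugation $\overline{a+\lambda b}=a-\lambda b$; $A^\dagger=\overline A^{\,T}$. Let $Q=\mathrm{diag}(I_n,-1)$, $q(z,w)=z^TQ\overline w$, $\mathrm U(n,1;\mathbb R\oplus\mathbb R)=\{A: A^\dagger QA=Q\}$, and $\mathrm U(\mathbb R\oplus\mathbb R)=\{u: u\overline u=1\}$. The geometry $\mathbb H^n_{\mathbb R\oplus\mathbb R}$ is the action of $\mathrm U(n,1;\mathbb R\oplus\mathbb R)$ on $\{z\in(\mathbb R\oplus\mathbb R)^{n+1}: q(z,z)=-1\}/\mathrm U(\mathbb R\oplus\mathbb R)$; equivalently it is the pair (automorphism group, point stabilizer) $\left(\mathrm U(n,1;\mathbb R\oplus\mathbb R),\ \left(\begin{smallmatrix}\mathrm U(n;\mathbb R\oplus\mathbb R)&0\\0&\mathrm U(\mathbb R\oplus\mathbb R)\end{smallmatrix}\right)\right)$, where $\mathrm U(n;\mathbb R\oplus\mathbb R)=\{A: A^\dagger A=I_n\}$. Point-hyperplane geometry of $\mathbb{RP}^n$: the underlying space is the set of pairs $(p,H)$ of a point $p\in\mathbb{RP}^n$ and a hyperplane $H\subset\mathbb{RP}^n$ with $p\notin H$, with the natural transitive action of $\mathrm{GL}(n+1;\mathbb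 R)$, $A.(p,H)=(Ap,A^{-T}H)$, where a hyperplane is represented by the projective class of a covector having it as kernel. Two homogeneous geometries given by pairs $(G,K)$, $(H,C)$ (Lie group, closed point stabilizer) are locally isomorphic if there is an isomorphism of Lie algebras $\mathfrak g\to\mathfrak h$ carrying $\mathfrak k$ onto $\mathfrak c$. *)

(* Defs.v *)
From HB Require Import structures.
From mathcomp Require Import all_boot all_order all_algebra all_field.
From mathcomp Require Import all_classical all_reals all_analysis.
From mathcomp Require Import ring.
Import Order.TTheory GRing.Theory Num.Theory.
Import numFieldNormedType.Exports.

Set Implicit Arguments.
Unset Strict Implicit.
Unset Printing Implicit Defensive.

Local Open Scope classical_set_scope.
Local Open Scope ring_scope.

(* [Split a b] is a + lambda b with lambda ^ 2 = 1. A record is used because  *)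
(* the library equips R * R with the componentwise product, which is the same *)
(* ring written in the basis of idempotents (1 +- lambda) / 2.                *)
Record splitnum (R : Type) := Split { repart : R; lampart : R }.

Section SplitAlgebra.
Variable R : fieldType.
Implicit Types (x y z : splitnum R) (a b : R).

Let to_pair x := (repart x, lampart x).
Let of_pair (p : R * R) := Split p.1 p.2.
Let to_pairK : cancel to_pair of_pair. Proof. by case. Qed.

HB.instance Definition _ := Choice.copy (splitnum R) (can_type to_pairK).

Definition splitnum_zero : splitnum R := Split 0 0.
Definition splitnum_opp x := Split (- repart x) (- lampart x).
Definition splitnum_add x y :=
  Split (repart x + repart y) (lampart x + lampart y).

Let addA : associative splitnum_add.
Proof. by case=> ? ? [? ?] [? ?]; rewrite /splitnum_add /= !addrA. Qed.
Let addC : commutative splitnum_add.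
Proof. by case=> ? ? [? ?]; congr Split; rewrite /= addrC. Qed.
Let add0 : left_id splitnum_zero splitnum_add.
Proof. by case=> ? ?; rewrite /splitnum_add /= !add0r. Qed.
Let addN : left_inverse splitnum_zero splitnum_opp splitnum_add.
Proof. by case=> ? ?; rewrite /splitnum_add /= !addNr. Qed.

HB.instance Definition _ := GRing.isZmodule.Build (splitnum R)
  addA addC add0 addN.

Definition splitnum_one : splitnum R := Split 1 0.
Definition splitnum_mul x y :=
  Split (repart x * repart y + lampart x * lampart y)
        (repart x * lampart y + lampart x * repart y).

Let mulA : associative splitnum_mul.
Proof. by case=> ? ? [? ?] [? ?]; congr Split; rewrite /=; ring. Qed.
Let mulC : commutative splitnum_mul.
Proof. by case=> ? ? [? ?]; congr Split; rewrite /=; ring. Qed.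
Let mul1 : left_id splitnum_one splitnum_mul.
Proof. by case=> ? ?; congr Split; rewrite /=; ring. Qed.
Let mulDl : left_distributive splitnum_mul splitnum_add.
Proof. by case=> ? ? [? ?] [? ?]; congr Split; rewrite /=; ring. Qed.
Let one_neq0 : splitnum_one != 0.
Proof. by apply/eqP => -[] /eqP; rewrite oner_eq0. Qed.

HB.instance Definition _ :=
  GRing.Zmodule_isComNzRing.Build (splitnum R) mulA mulC mul1 mulDl one_neq0.

Definition splitnum_scale a x := Split (a * repart x) (a * lampart x).

Let scaleA a b x :
  splitnum_scale a (splitnum_scale b x) = splitnum_scale (a * b) x.
Proof. by case: x => ? ?; congr Split; rewrite /= mulrA. Qed.
Let scale1 : left_id 1 splitnum_scale.
Proof. by case=> ? ?; congr Split; rewrite /= mul1r. Qed.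
Let scaleDr : right_distributive splitnum_scale +%R.
Proof. by move=> ? [? ?] [? ?]; congr Split; rewrite /= mulrDr. Qed.
Let scaleDl x : {morph splitnum_scale^~ x : a b / a + b}.
Proof. by case: x => ? ? ? ?; congr Split; rewrite /= mulrDl. Qed.

HB.instance Definition _ :=
  GRing.Zmodule_isLmodule.Build R (splitnum R) scaleA scale1 scaleDr scaleDl.

Let scaleAl a x y : a *: (x * y) = (a *: x) * y.
Proof. by case: x y => ? ? [? ?]; congr Split; rewrite /=; ring. Qed.

HB.instance Definition _ := GRing.Lmodule_isLalgebra.Build R (splitnum R)
  scaleAl.
HB.instance Definition _ := GRing.Lalgebra_isComAlgebra.Build R (splitnum R).

Let split_vect_axiom : Vector.axiom 2 (splitnum R).
Proof.
exists (fun x => \row_(i < 2) if i == 0 then repart x else lampart x).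
  by move=> a x y; apply/rowP=> i; rewrite !mxE; case: ifP.
exists (fun v : 'rV_2 => Split (v 0 0) (v 0 1)).
  by case=> a b; rewrite !mxE.
move=> v; apply/rowP=> i; rewrite mxE.
case: (unliftP ord0 i) => [j|] -> //=.
by rewrite ord1; congr (v _ _); apply/val_inj.
Qed.

HB.instance Definition _ := Lmodule_hasFinDim.Build R (splitnum R)
  split_vect_axiom.
HB.instance Definition _ := Algebra_isFalgebra.Build R (splitnum R).

Definition splitnum_conj x : splitnum R := Split (repart x) (- lampart x).

Definition lambda : splitnum R := Split 0 1.

Lemma lambda2 : lambda * lambda = 1.
Proof. by congr Split; rewrite /=; ring. Qed.

Lemma splitE x : x = (repart x)%:A + lambda * (lampart x)%:A.
Proof. by case: x => a b; congr Split; rewrite /=; ring. Qed.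

End SplitAlgebra.

(* Lie groups are given as groups G of invertible matrices over a             *)
(* finite-dimensional real algebra, closed among invertible matrices; their   *)
(* Lie algebra is the tangent space at the identity, with the commutator as   *)
(* bracket.                                                                   *)
Section LieAlgebra.
Variables (R : realType) (A : falgType R) (m : nat).

(* A map into a finite-dimensional real vector space is differentiable iff    *)
(* its composites with all linear functionals are.                            *)
Definition has_velocity (g : R -> 'M[A]_m) (t : R) (X : 'M[A]_m) :=
  forall (i j : 'I_m) (f : {linear A -> R^o}),
    is_derive t (1 : R) (fun s : R => f (g s i j) : R) (f (X i j) : R).

Definition lie_algebra (G : set 'M[A]_m) : set 'M[A]_m :=
  [set X | exists g : R -> 'M[A]_m,
    [/\ g 0 = 1%:M,
        has_velocity g 0 X,
        \forall t \near (0 : R), G (g t) &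
        \forall t \near (0 : R), exists Y, has_velocity g t Y]].

Definition lie_bracket (X Y : 'M[A]_m) : 'M[A]_m := X *m Y - Y *m X.

Definition real_scale (a : R) (X : 'M[A]_m) : 'M[A]_m := a%:A *: X.

End LieAlgebra.

Section LocalIsomorphism.
Variables (R : realType) (A B : falgType R) (m p : nat).

(* Only the restriction of [phi] to [lg] matters. *)
Definition lie_algebra_isomorphism (lg : set 'M[A]_m) (lh : set 'M[B]_p)
    (phi : 'M[A]_m -> 'M[B]_p) :=
  [/\ set_bij lg lh phi,
      {in lg &, forall X Y, phi (X + Y) = phi X + phi Y},
      {in lg, forall X (a : R),
        phi (real_scale a X) = real_scale a (phi X)} &
      {in lg &, forall X Y,
        phi (lie_bracket X Y) = lie_bracket (phi X) (phi Y)}].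

Definition locally_isomorphic (G K : set 'M[A]_m) (H C : set 'M[B]_p) :=
  exists phi : 'M[A]_m -> 'M[B]_p,
    lie_algebra_isomorphism (lie_algebra G) (lie_algebra H) phi /\
    phi @` lie_algebra K = lie_algebra C.

End LocalIsomorphism.

Definition stabilizer (T X : Type) (G : set T) (act : T -> X -> X) (x : X) :
    set T :=
  [set g | G g /\ act g x = x].

Section PointHyperplane.
Variables (R : realType) (N : nat).

(* [R^o] is R seen as an algebra over itself; for RP^n one takes N = n + 1.  *)
Definition general_linear : set 'M[R^o]_N :=
  [set M | (M : 'M[R]_N) \in unitmx].

Definition projective_class (v : 'cV[R]_N) : set 'cV[R]_N :=
  [set w | exists2 a : R, a != 0 & w = a *: v].

Definition projective_space : set (set 'cV[R]_N) :=
  [set p | exists2 v, v != 0 & p = projective_class v].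

(* Covectors are also stored as columns [f], acting by [f^T *m v]; a          *)
(* hyperplane is encoded by the projective class of its covectors.            *)
Definition points_of_hyperplane (H : set 'cV[R]_N) : set (set 'cV[R]_N) :=
  [set p | projective_space p /\
           forall f v, H f -> p v -> f^T *m v = 0].

Definition point_hyperplane_space : set (set 'cV[R]_N * set 'cV[R]_N) :=
  [set pH | [/\ projective_space pH.1, projective_space pH.2 &
                ~ points_of_hyperplane pH.2 pH.1]].

Definition point_hyperplane_act (M : 'M[R^o]_N)
    (pH : set 'cV[R]_N * set 'cV[R]_N) : set 'cV[R]_N * set 'cV[R]_N :=
  let M' : 'M[R]_N := M in
  (mulmx M' @` pH.1, mulmx (invmx M')^T @` pH.2).

End PointHyperplane.

Arguments general_linear R N : clear implicits.

Section Hyperbolic.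
Variables (R : realType) (n : nat).
Local Notation S := (splitnum R).

Definition adjoint (k l : nat) (M : 'M[S]_(k, l)) : 'M[S]_(l, k) :=
  (map_mx (@splitnum_conj R) M)^T.

Definition Qmx : 'M[S]_(n + 1) := block_mx 1%:M 0 0 (-1)%:M.

Definition qform (z w : 'cV[S]_(n + 1)) : S :=
  (z^T *m Qmx *m map_mx (@splitnum_conj R) w) 0 0.

Definition unitary_n1 : set 'M[S]_(n + 1) :=
  [set M | adjoint M *m Qmx *m M = Qmx].

Definition unitary_n : set 'M[S]_n := [set M | adjoint M *m M = 1%:M].

Definition unitary_scalar : set S := [set u | u * splitnum_conj u = 1].

Definition unitary_class (z : 'cV[S]_(n + 1)) : set 'cV[S]_(n + 1) :=
  [set u *: z | u in unitary_scalar].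

Definition hyperbolic_space : set (set 'cV[S]_(n + 1)) :=
  [set c | exists2 z, qform z z = -1 & c = unitary_class z].

Definition hyperbolic_act (M : 'M[S]_(n + 1)) (c : set 'cV[S]_(n + 1)) :
    set 'cV[S]_(n + 1) :=
  mulmx M @` c.

Definition hyperbolic_base : set 'cV[S]_(n + 1) :=
  unitary_class (col_mx 0 1%:M).

Definition hyperbolic_block_group : set 'M[S]_(n + 1) :=
  [set M | exists D u, [/\ unitary_n D, unitary_scalar u &
                           M = block_mx D 0 0 u%:M]].

End Hyperbolic.

Arguments unitary_n1 R n : clear implicits.
Arguments hyperbolic_base R n : clear implicits.
Arguments hyperbolic_block_group R n : clear implicits.

Section HyperbolicBase.
Variables (R : realType) (n : nat).
Local Notation S := (splitnum R).

Let conj_scale1 : unitary_scalar (1 : S).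
Proof. by congr Split; rewrite /=; ring. Qed.

Fact conj_is_zmod_morphism : zmod_morphism (@splitnum_conj R).
Proof. by case=> ? ? [? ?]; congr Split; rewrite /=; ring. Qed.
Fact conj_is_monoid_morphism : monoid_morphism (@splitnum_conj R).
Proof.
by split=> [|[? ?] [? ?]]; congr Split; rewrite /=; ring.
Qed.
HB.instance Definition _ := GRing.isZmodMorphism.Build S S (@splitnum_conj R)
  conj_is_zmod_morphism.
HB.instance Definition _ := GRing.isMonoidMorphism.Build S S (@splitnum_conj R)
  conj_is_monoid_morphism.

Lemma hyperbolic_base_in : hyperbolic_space (hyperbolic_base R n).
Proof.
exists (col_mx 0 1%:M) => //.
rewrite /qform /Qmx tr_col_mx map_col_mx mul_row_block mul_row_col.
rewrite !map_scalar_mx !map_mx0 rmorph1 !(trmx0, mul0mx, mulmx0, add0r).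
by rewrite tr_scalar_mx mul1mx mulmx1 !mxE eqxx.
Qed.

Lemma stabilizer_hyperbolic_base :
  stabilizer (unitary_n1 R n) (@hyperbolic_act R n) (hyperbolic_base R n) =
  hyperbolic_block_group R n.
Proof.
apply/seteqP; split=> M.
  case=> MU Me.
  have [u uU Mu] : exists2 u, unitary_scalar u &
      u *: col_mx 0 1%:M = M *m (col_mx 0 1%:M : 'cV[S]_(n + 1)).
    have : hyperbolic_act M (hyperbolic_base R n) (M *m col_mx 0 1%:M).
      exists (col_mx 0 1%:M) => //; exists 1; [exact: conj_scale1|].
      by rewrite scale1r.
    by rewrite Me => -[u uU e]; exists u.
  move: MU Mu; rewrite /unitary_n1 /= -[M]submxK.
  move: (ulsubmx M) (ursubmx M) (dlsubmx M) (drsubmx M) => A B C D.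
  rewrite mul_block_col !(mulmx0, mulmx1, add0r) scale_col_mx scaler0.
  rewrite scale_scalar_mx mulr1 => MU /eq_col_mx[BE DE].
  move: MU; rewrite -{B}BE -{D}DE /adjoint /Qmx map_block_mx tr_block_mx.
  rewrite !mulmx_block !(map_mx0, trmx0, mulmx0, mul0mx, addr0, add0r, mulmx1).
  case/eq_block_mx => E1 E2 _ _.
  have C0 : C = 0.
    move: E2; rewrite -mulmxA -scalar_mxM mul_mx_scalar.
    move=> /(congr1 (fun X => (- splitnum_conj u) *: X)).
    rewrite scalerA scaler0 mulN1r mulrNN mulrC uU scale1r => e.
    apply/matrixP=> i j; move/matrixP: e => /(_ j i).
    rewrite !mxE => /(congr1 (@splitnum_conj R)); rewrite rmorph0 => <-.
    by case: (C i j) => ? ?; congr Split; rewrite /= opprK.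
  exists A, u; split=> //; last by rewrite C0.
  by move: E1; rewrite C0 mulmx0 addr0.
case=> A [u [AU uU ->]]; split.
  rewrite /unitary_n1 /= /adjoint /Qmx map_block_mx tr_block_mx !mulmx_block.
  rewrite !(map_mx0, trmx0, mulmx0, mul0mx, addr0, add0r, mulmx1).
  rewrite map_scalar_mx tr_scalar_mx -!scalar_mxM AU; congr block_mx.
  by rewrite mulrAC [X in X * _]mulrC (uU : _ = _) mul1r.
have acte v : block_mx A 0 0 u%:M *m (v *: col_mx 0 1%:M) =
    (u * v) *: col_mx 0 1%:M :> 'cV[S]_(n + 1).
  rewrite -scalemxAr mul_block_col !(mulmx0, mulmx1, mul0mx, addr0, add0r).
  by rewrite !scale_col_mx !scaler0 !scale_scalar_mx mulr1 mulrC.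
have UM (a b : S) : unitary_scalar a -> unitary_scalar b ->
    unitary_scalar (a * b).
  by rewrite /unitary_scalar /= rmorphM mulrACA => -> ->; rewrite mulr1.
apply/seteqP; split=> w.
  by case=> _ [v vU <-] <-; exists (u * v); rewrite ?acte//; exact: UM.
case=> v vU <-; exists ((splitnum_conj u * v) *: col_mx 0 1%:M).
  exists (splitnum_conj u * v) => //; apply: UM => //.
  rewrite /unitary_scalar /= -rmorphM (uU : _ = _) rmorph1 //.
by rewrite acte mulrA (uU : _ = _) mul1r.
Qed.

End HyperbolicBase.

(* Main.v *)
Require Import Defs.
From mathcomp Require Import all_boot all_order all_algebra all_field.
From mathcomp Require Import all_classical all_reals all_analysis.
From HB Require Import structures.
From mathcomp Require Import ring.
Import Order.TTheory GRing.Theory Num.Theory.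
Import numFieldNormedType.Exports.

(** The idempotents e+ = (1 + lambda) / 2 and e- = (1 - lambda) / 2 identify
    the split numbers with two copies of the reals, and conjugation exchanges
    the copies.  A matrix M over the split numbers is thus a pair (M+, M-) of
    real matrices, and the equation defining U(n, 1) becomes
    (M-)^T J M+ = J with J = diag(1, .., 1, -1): it says that M+ is invertible
    and that M- = J (M+)^-T J.  So M |-> M+ is a group isomorphism from U(n, 1)
    onto GL(n + 1); call F its inverse ([unitary_of_real]).

    A vector z with q(z, z) = -1 is likewise a pair (z+, z-) of real vectors,
    and J z-, read as a covector, takes the value -1 on z+.  Multiplying z by
    a unitary scalar, whose components are some a and a^-1, does not change the
    two projective classes [z+] and [J z-].  So the class of z determines a
    point and a hyperplane not through it, and the group isomorphism carries
    the stabilizer of this pair onto that of the class of z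
    ([stabilizer_unitary_of_real]).  The given pair x need not be this one, but
    GL acts transitively on such pairs ([point_hyperplane_transitive]), so it
    is enough to conjugate first by a P in GL.

    The resulting group isomorphism g |-> F(P g P^-1) and its inverse carry
    differentiable curves to differentiable curves.  Hence their derivatives at
    the identity exchange the Lie algebras of corresponding groups
    ([lie_algebra_to_unitary], [lie_algebra_of_unitary]).  The derivative of F
    at the identity is X |-> (X, - J X^T J), which follows from that of matrix
    inversion ([real_velocityV]) and is a morphism of Lie algebras by
    inspection. *)

Set Implicit Arguments.
Unset Strict Implicit.
Unset Printing Implicit Defensive.

Local Open Scope classical_set_scope.
Local Open Scope ring_scope.

(** * Velocities of curves of matrices *)
Section Velocity.
Variables (R : realType) (A : falgType R) (m : nat).
Implicit Types (g h : R -> 'M[A]_m) (t : R) (X Y : 'M[A]_m).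

Lemma near_eq_has_velocity g h t X :
  (\forall s \near t, g s = h s) -> has_velocity g t X -> has_velocity h t X.
Proof.
move=> gh gX i j f; apply: near_eq_is_derive (gX i j f).
by apply: filterS gh => s /= ->.
Qed.

(** The coordinates in a basis are linear functionals that separate points. *)
Lemma has_velocity_unique g t X Y :
  has_velocity g t X -> has_velocity g t Y -> X = Y.
Proof.
move=> gX gY; apply/matrixP=> i j.
rewrite (coord_vbasis (memvf (X i j))) (coord_vbasis (memvf (Y i j))).
apply: eq_bigr => k _; congr (_ *: _).
have /@derive_val <- := gX i j (coord (vbasis fullv) k).
by have /@derive_val <- := gY i j (coord (vbasis fullv) k).
Qed.

Lemma has_velocity_linear (B : falgType R) (L : {linear A -> B}) g t X :
  has_velocity g t X ->
  has_velocity (fun s => map_mx L (g s)) t (map_mx L X).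
Proof.
move=> gX i j f; rewrite mxE.
under eq_fun do rewrite mxE.
exact: (gX i j (f \o L : {linear A -> R^o})).
Qed.

End Velocity.

Section LieMap.
Variables (R : realType) (A B : falgType R) (m p : nat).

(** A differentiable map that fixes the identity carries curves through the
    identity to curves through the identity, so its derivative there maps one
    Lie algebra into the other.  Here [dF a] is the derivative of [F] at [a], required
    along differentiable curves only; off the identity it serves to show that
    the image curve is differentiable near 0. *)
Lemma lie_algebra_map (G : set 'M[A]_m) (H : set 'M[B]_p)
    (F : 'M[A]_m -> 'M[B]_p) (dF : 'M[A]_m -> 'M[A]_m -> 'M[B]_p) X :
  F 1%:M = 1%:M -> (forall a, G a -> H (F a)) -> G 1%:M ->
  (forall g t Y, G (g t) -> has_velocity g t Y ->
     has_velocity (fun s => F (g s)) t (dF (g t) Y)) ->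
  lie_algebra G X -> lie_algebra H (dF 1%:M X).
Proof.
move=> F1 GH G1 dFP [g [g0 gX gG gD]]; exists (fun s => F (g s)); split.
- by rewrite g0.
- by rewrite -g0; apply: dFP => //; rewrite g0.
- by near do apply: GH.
- near=> t.
  have [Y gY] : exists Y, has_velocity g t Y by near: t.
  by exists (dF (g t) Y); apply: dFP => //; near: t.
Unshelve. all: by end_near. Qed.

End LieMap.

Section RealVelocity.
Variables (R : realType) (N : nat).
Implicit Types (g h : R -> 'M[R]_N) (t : R) (X Y : 'M[R]_N).

(** A linear functional on the one-dimensional space R is a multiplication by a
    constant, so that testing the identity functional suffices. *)
Lemma real_velocityP g t X :
  has_velocity (A := R^o) g t X <->
  forall i j, is_derive t (1 : R) (fun s => g s i j) (X i j).
Proof.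
split=> [gX i j|gX i j f]; first exact: (gX i j (idfun : {linear R^o -> R^o})).
have fE (a : R^o) : f a = (f 1 : R) * (a : R).
  rewrite -[a in LHS]mulr1 (linearZ_LR f (a : R) (1 : R^o)).
  by rewrite /GRing.scale /= mulrC.
rewrite fE; under eq_fun do rewrite fE.
exact: (@is_deriveZ _ _ _ (fun s => g s i j) (f 1)).
Qed.

Lemma real_velocity_cst t (X : 'M[R]_N) :
  has_velocity (A := R^o) (fun _ => X) t 0.
Proof. by apply/real_velocityP => i j; rewrite mxE; exact: is_derive_cst. Qed.

Lemma real_velocity_tr g t X :
  has_velocity (A := R^o) g t X ->
  has_velocity (A := R^o) (fun s => (g s)^T) t X^T.
Proof.
move=> /real_velocityP gX; apply/real_velocityP => i j.
by rewrite mxE; under eq_fun do rewrite mxE.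
Qed.

Lemma real_velocityM g h t X Y :
  has_velocity (A := R^o) g t X -> has_velocity (A := R^o) h t Y ->
  has_velocity (A := R^o) (fun s => g s *m h s) t (X *m h t + g t *m Y).
Proof.
move=> /real_velocityP gX /real_velocityP hY; apply/real_velocityP => i j.
have -> : (fun s => (g s *m h s) i j) =
    \sum_(k < N) ((fun s => g s i k) * (fun s => h s k j)).
  by apply/funext => s; rewrite mxE fct_sumE.
rewrite !mxE -big_split /=; apply: is_derive_sum => k.
by apply: is_derive_eq; rewrite addrC [X i k * _]mulrC.
Qed.

Lemma real_velocity_conj (C D : 'M[R]_N) g t X :
  has_velocity (A := R^o) g t X ->
  has_velocity (A := R^o) (fun s => C *m g s *m D) t (C *m X *m D).
Proof.
move=> gX.
have := real_velocityM (real_velocityM (real_velocity_cst t C) gX)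
  (real_velocity_cst t D).
by rewrite mul0mx add0r mulmx0 addr0.
Qed.

Lemma derivable_prod (I : Type) (r : seq I) (c : I -> R -> R) t :
  (forall i, derivable (c i) t 1) ->
  derivable (fun s => \prod_(i <- r) c i s) t 1.
Proof.
move=> cD; elim: r => [|i r IH].
  by under eq_fun do rewrite big_nil; exact: derivable_cst.
under eq_fun do rewrite big_cons.
exact: (derivableM (cD i) IH).
Qed.

End RealVelocity.

Lemma derivable_det (R : realType) (N : nat) (g : R -> 'M[R]_N) t :
  (forall i j, derivable (fun s => g s i j) t 1) ->
  derivable (fun s => \det (g s)) t 1.
Proof.
move=> gD; rewrite /determinant.
elim: (index_enum _) => [|u r IH].
  by under eq_fun do rewrite big_nil; exact: derivable_cst.
under eq_fun do rewrite big_cons.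
apply: derivableD IH.
apply: (@derivableM _ _ (fun _ => _)); first exact: derivable_cst.
by apply: derivable_prod => i.
Qed.

Section Inverse.
Variables (R : realType) (N : nat).
Implicit Types (g : R -> 'M[R]_N) (t : R) (X : 'M[R]_N).

(** The determinant of a differentiable curve is differentiable, so
    continuous. *)
Lemma near_unitmx g t X : has_velocity (A := R^o) g t X -> g t \in unitmx ->
  \forall s \near t, g s \in unitmx.
Proof.
move=> /real_velocityP gX gt.
have /derivable1_diffP/differentiable_continuous dC :
  derivable (fun s => \det (g s)) t 1 by apply: derivable_det.
have d0 : \det (g t) != 0 by rewrite -unitfE -unitmxE.
have : \forall s \near t, \det (g s) != 0 by exact: (cvgr_neq0 _ dC d0).
apply: filterS => s.
by rewrite unitmxE unitfE.
Qed.

(** Cramer's formula shows that the inverse is differentiable; differentiating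
    g g^-1 = 1 then gives the value of the derivative. *)
Lemma real_velocityV g t X :
  g t \in unitmx -> has_velocity (A := R^o) g t X ->
  has_velocity (A := R^o) (fun s => invmx (g s)) t
    (- (invmx (g t) *m X *m invmx (g t))).
Proof.
move=> gt gX; have gU := near_unitmx gX gt.
have gD i j : derivable (fun s => g s i j) t 1.
  by have /real_velocityP/(_ i j)[] := gX.
have [Y hY] : exists Y, has_velocity (A := R^o) (fun s => invmx (g s)) t Y.
  exists (\matrix_(i, j) 'D_1 (fun s => (\det (g s))^-1 * (\adj (g s)) i j) t).
  apply/real_velocityP => i j; rewrite mxE.
  have cofD : derivable (fun s => (\det (g s))^-1 * (\adj (g s)) i j) t 1.
    apply: (@derivableM _ _ (fun s => (\det (g s))^-1)).
      apply: derivableV; last exact: derivable_det.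
      by rewrite -unitfE -unitmxE.
    under eq_fun do rewrite mxE.
    apply: (@derivableM _ _ (fun _ => _)); first exact: derivable_cst.
    apply: (derivable_det (g := fun s => row' j (col' i (g s)))) => k l.
    by under eq_fun do rewrite !mxE; exact: gD.
  apply: near_eq_is_derive (derivableP cofD).
  by apply: filterS gU => s gs; rewrite /invmx gs [RHS]mxE.
suff -> : - (invmx (g t) *m X *m invmx (g t)) = Y by [].
have := has_velocity_unique
  (near_eq_has_velocity _ (real_velocityM gX hY)) (real_velocity_cst t 1%:M).
move=> /(_ ltac:(by apply: filterS gU => s /mulmxV)) e.
apply/eqP; rewrite -subr_eq0 -opprD oppr_eq0; apply/eqP.
rewrite -[Y](mulKmx gt) -mulmxA -mulmxDr.
by rewrite e mulmx0.
Qed.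

End Inverse.

(** * Split numbers and the idempotents (1 +- lambda) / 2 *)
Section Idempotents.
Variable R : realType.
Local Notation S := (splitnum R).
Implicit Types (x y : S) (a b c d : R).

(** The coordinates of [x] on the idempotents: x = x+ e+ + x- e-. *)
Definition split_plus x : R := repart x + lampart x.
Definition split_minus x : R := repart x - lampart x.
Definition split_join a b : S := Defs.Split ((a + b) / 2) ((a - b) / 2).

Lemma split_plusK a b : split_plus (split_join a b) = a.
Proof. by rewrite /split_plus /=; field. Qed.

Lemma split_minusK a b : split_minus (split_join a b) = b.
Proof. by rewrite /split_minus /=; field. Qed.

Lemma split_joinK x : split_join (split_plus x) (split_minus x) = x.
Proof.
by case: x => a b; congr Defs.Split; rewrite /split_plus /split_minus /=; field.
Qed.

Lemma split_eqP x y :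
  split_plus x = split_plus y -> split_minus x = split_minus y -> x = y.
Proof. by move=> e1 e2; rewrite -(split_joinK x) e1 e2 split_joinK. Qed.

Fact split_plus_zmod : zmod_morphism split_plus.
Proof. by case=> ? ? [? ?]; rewrite /split_plus /=; ring. Qed.
Fact split_plus_monoid : monoid_morphism split_plus.
Proof. by split=> [|[? ?] [? ?]]; rewrite /split_plus /=; ring. Qed.
HB.instance Definition _ := GRing.isZmodMorphism.Build S R split_plus
  split_plus_zmod.
HB.instance Definition _ := GRing.isMonoidMorphism.Build S R split_plus
  split_plus_monoid.

Fact split_minus_zmod : zmod_morphism split_minus.
Proof. by case=> ? ? [? ?]; rewrite /split_minus /=; ring. Qed.
Fact split_minus_monoid : monoid_morphism split_minus.
Proof. by split=> [|[? ?] [? ?]]; rewrite /split_minus /=; ring. Qed.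
HB.instance Definition _ := GRing.isZmodMorphism.Build S R split_minus
  split_minus_zmod.
HB.instance Definition _ := GRing.isMonoidMorphism.Build S R split_minus
  split_minus_monoid.

(** The same map with codomain R seen as an algebra over itself, which carries
    the linear structure that [has_velocity_linear] expects. *)
Definition split_plus_linear : S -> R^o := split_plus.
Fact split_plus_linear_subproof : linear split_plus_linear.
Proof.
move=> a [? ?] [? ?].
by rewrite /split_plus_linear /split_plus /GRing.scale /=; ring.
Qed.
HB.instance Definition _ := GRing.isLinear.Build R S R^o *:%R
  split_plus_linear split_plus_linear_subproof.

Lemma split_plus_conj x : split_plus (splitnum_conj x) = split_minus x.
Proof. by []. Qed.

Lemma split_minus_conj x : split_minus (splitnum_conj x) = split_plus x.
Proof. by rewrite /split_minus /= opprK. Qed.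

Definition plus_mx k l (M : 'M[S]_(k, l)) : 'M[R]_(k, l) := map_mx split_plus M.
Definition minus_mx k l (M : 'M[S]_(k, l)) : 'M[R]_(k, l) :=
  map_mx split_minus M.
Definition join_mx k l (C D : 'M[R]_(k, l)) : 'M[S]_(k, l) :=
  \matrix_(i, j) split_join (C i j) (D i j).

Lemma plus_mxK k l (C D : 'M[R]_(k, l)) : plus_mx (join_mx C D) = C.
Proof. by apply/matrixP => i j; rewrite !mxE split_plusK. Qed.

Lemma minus_mxK k l (C D : 'M[R]_(k, l)) : minus_mx (join_mx C D) = D.
Proof. by apply/matrixP => i j; rewrite !mxE split_minusK. Qed.

Lemma split_mxP k l (M N : 'M[S]_(k, l)) :
  plus_mx M = plus_mx N -> minus_mx M = minus_mx N -> M = N.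
Proof.
move=> /matrixP e1 /matrixP e2; apply/matrixP => i j.
by apply: split_eqP; [move: (e1 i j) | move: (e2 i j)]; rewrite !mxE.
Qed.

Lemma join_mxM k l r (C C' : 'M[R]_(k, l)) (D D' : 'M[R]_(l, r)) :
  join_mx C C' *m join_mx D D' = join_mx (C *m D) (C' *m D').
Proof.
apply: split_mxP; rewrite ?plus_mxK ?minus_mxK.
  by rewrite /plus_mx map_mxM -!/(plus_mx _) !plus_mxK.
by rewrite /minus_mx map_mxM -!/(minus_mx _) !minus_mxK.
Qed.

Lemma join_mxD k l (C C' D D' : 'M[R]_(k, l)) :
  join_mx C C' + join_mx D D' = join_mx (C + D) (C' + D').
Proof.
apply: split_mxP; rewrite ?plus_mxK ?minus_mxK.
  by rewrite /plus_mx map_mxD -!/(plus_mx _) !plus_mxK.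
by rewrite /minus_mx map_mxD -!/(minus_mx _) !minus_mxK.
Qed.

Lemma join_mxN k l (C C' : 'M[R]_(k, l)) :
  - join_mx C C' = join_mx (- C) (- C').
Proof.
apply: split_mxP; rewrite ?plus_mxK ?minus_mxK.
  by rewrite /plus_mx map_mxN -!/(plus_mx _) !plus_mxK.
by rewrite /minus_mx map_mxN -!/(minus_mx _) !minus_mxK.
Qed.

Lemma join_mxZ k l a b (C C' : 'M[R]_(k, l)) :
  split_join a b *: join_mx C C' = join_mx (a *: C) (b *: C').
Proof.
apply: split_mxP; rewrite ?plus_mxK ?minus_mxK.
  by rewrite /plus_mx map_mxZ -!/(plus_mx _) !plus_mxK [X in X *: _]split_plusK.
rewrite /minus_mx map_mxZ -!/(minus_mx _) !minus_mxK.
by rewrite [X in X *: _]split_minusK.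
Qed.

Lemma join_mx1 k : join_mx 1%:M 1%:M = 1%:M :> 'M[S]_k.
Proof.
apply: split_mxP; rewrite ?plus_mxK ?minus_mxK.
  by rewrite /plus_mx map_mx1.
by rewrite /minus_mx map_mx1.
Qed.

Lemma split_scalar a : a%:A = split_join a a :> S.
Proof. by congr Defs.Split; rewrite /=; field. Qed.

(** A linear functional on split numbers is a combination of the two idempotent
    coordinates. *)
Lemma has_velocity_join N (g h : R -> 'M[R]_N) t (X Y : 'M[R]_N) :
  has_velocity (A := R^o) g t X -> has_velocity (A := R^o) h t Y ->
  has_velocity (fun s => join_mx (g s) (h s)) t (join_mx X Y).
Proof.
move=> /real_velocityP gX /real_velocityP hY i j f.
pose p := f (split_join 1 0) : R; pose q := f (split_join 0 1) : R.
have fE a b : f (split_join a b) = p * a + q * b :> R.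
  have -> : split_join a b = a *: split_join 1 0 + b *: split_join 0 1.
    by congr Defs.Split; rewrite /=; field.
  by rewrite linearD !linearZ_LR /GRing.scale /= [p * _]mulrC [q * _]mulrC.
rewrite mxE fE; under eq_fun do rewrite mxE fE.
exact: is_deriveD (is_deriveZ p (gX i j)) (is_deriveZ q (hY i j)).
Qed.

Lemma has_velocity_plus N (g : R -> 'M[S]_N) t X :
  has_velocity g t X ->
  has_velocity (A := R^o) (fun s => plus_mx (g s)) t (plus_mx X).
Proof. exact: (has_velocity_linear split_plus_linear). Qed.

End Idempotents.

(** * The isomorphism between GL(n + 1) and U(n, 1) *)
Section Unitary.
Variables (R : realType) (n : nat).
Local Notation S := (splitnum R).
Local Notation N := (n + 1)%N.
Implicit Types (C D : 'M[R]_N) (M : 'M[S]_N) (z : 'cV[S]_N).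

Definition lorentz_mx : 'M[R]_N := block_mx 1%:M 0 0 (-1)%:M.
Local Notation J := lorentz_mx.

Lemma trmx_lorentz : J^T = J.
Proof. by rewrite /J tr_block_mx !trmx0 !tr_scalar_mx. Qed.

Lemma lorentz_sqr : J *m J = 1%:M.
Proof.
rewrite /J mulmx_block !(mul0mx, mulmx0, addr0, add0r) -!scalar_mxM.
by rewrite mulr1 mulrNN mulr1 -scalar_mx_block.
Qed.

Lemma lorentzK k (X : 'M[R]_(N, k)) : J *m (J *m X) = X.
Proof. by rewrite mulmxA lorentz_sqr mul1mx. Qed.

Lemma lorentzKr k (X : 'M[R]_(k, N)) : X *m J *m J = X.
Proof. by rewrite -mulmxA lorentz_sqr mulmx1. Qed.

Lemma Qmx_join : Qmx R n = join_mx J J.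
Proof.
apply: split_mxP; rewrite ?plus_mxK ?minus_mxK.
  by rewrite /plus_mx map_block_mx !map_scalar_mx !map_mx0 rmorphN rmorph1.
by rewrite /minus_mx map_block_mx !map_scalar_mx !map_mx0 rmorphN rmorph1.
Qed.

Lemma adjoint_join M : adjoint M = join_mx (minus_mx M)^T (plus_mx M)^T.
Proof.
apply: split_mxP; rewrite ?plus_mxK ?minus_mxK; apply/matrixP => i j.
  by rewrite !mxE.
by rewrite !mxE split_minus_conj.
Qed.

Lemma join_plus_minus k l (M : 'M[S]_(k, l)) :
  join_mx (plus_mx M) (minus_mx M) = M.
Proof. by apply: split_mxP; rewrite ?plus_mxK ?minus_mxK. Qed.

(** The two idempotent components of the defining equation are transposes of
    each other, because conjugation exchanges the components. *)
Lemma unitary_n1P M :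
  unitary_n1 R n M <-> (minus_mx M)^T *m J *m plus_mx M = J.
Proof.
rewrite /unitary_n1 /= adjoint_join Qmx_join -{3}(join_plus_minus M) !join_mxM.
split=> [/(congr1 (@plus_mx R _ _))|e]; first by rewrite !plus_mxK.
rewrite e; congr join_mx; move/(congr1 trmx): e.
by rewrite !trmx_mul trmx_lorentz trmxK mulmxA.
Qed.

(** The solution of the equation in [unitary_n1P] with plus component [C]. *)
Definition unitary_of_real C : 'M[S]_N := join_mx C (J *m (invmx C)^T *m J).

Lemma unitary_of_realP C : C \in unitmx -> unitary_n1 R n (unitary_of_real C).
Proof.
move=> Cu; apply/unitary_n1P; rewrite minus_mxK plus_mxK.
rewrite !trmx_mul trmx_lorentz trmxK mulmxA lorentzKr.
by rewrite mulmxKV.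
Qed.

Lemma plus_mx_unit M : unitary_n1 R n M -> plus_mx M \in unitmx.
Proof.
move/unitary_n1P/(congr1 (mulmx J)); rewrite lorentz_sqr mulmxA => e.
by have [] := mulmx1_unit e.
Qed.

Lemma unitary_of_plus M :
  unitary_n1 R n M -> unitary_of_real (plus_mx M) = M.
Proof.
move=> MU; have Mu := plus_mx_unit MU; move/unitary_n1P: MU => e.
apply: split_mxP; rewrite ?plus_mxK ?minus_mxK //.
have -> : (invmx (plus_mx M))^T = (J *m (minus_mx M)^T *m J)^T.
  congr trmx; rewrite -[invmx _]mul1mx -lorentz_sqr -{2}e.
  by rewrite !mulmxA mulmxK.
by rewrite !trmx_mul trmx_lorentz trmxK !mulmxA lorentz_sqr mul1mx lorentzKr.
Qed.

Lemma unitary_of_real1 : unitary_of_real 1%:M = 1%:M.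
Proof.
by rewrite /unitary_of_real invmx1 trmx1 mulmx1 lorentz_sqr join_mx1.
Qed.

Lemma split_unitary_scalarP (u : S) :
  unitary_scalar u <-> split_plus u * split_minus u = 1.
Proof.
rewrite /unitary_scalar /=; split=> [/(congr1 (@split_plus R))|e].
  by rewrite rmorphM rmorph1.
by apply: split_eqP; rewrite rmorphM rmorph1 //= split_minus_conj mulrC.
Qed.

(** This is the minus component of q(z, z) = -1; the left-hand side is the
    value at z+ of the covector J z-. *)
Lemma qform_plus z : qform z z = -1 ->
  (J *m minus_mx z)^T *m plus_mx z = (-1)%:M.
Proof.
move=> /(congr1 (@split_minus R)) e.
apply/matrixP => i j; rewrite !ord1 [RHS]mxE eqxx mulr1n.
move: e; rewrite rmorphN rmorph1 => <-.
rewrite /qform.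
set W := _ *m _ *m _; have -> : split_minus (W 0 0) = (minus_mx W) 0 0.
  by rewrite [RHS]mxE.
rewrite {}/W.
rewrite /minus_mx !map_mxM -!/(minus_mx _) Qmx_join minus_mxK.
have -> : minus_mx (map_mx (@splitnum_conj R) z) = plus_mx z.
  by apply/matrixP => k l; rewrite !mxE split_minus_conj.
by rewrite trmx_mul trmx_lorentz /minus_mx map_trmx.
Qed.

End Unitary.

(** * Point-hyperplane pairs and the transitivity of GL *)
Section PointHyperplanePairs.
Variables (R : realType) (N : nat).
Implicit Types (M P g : 'M[R]_N) (v f : 'cV[R]_N)
  (x : set 'cV[R]_N * set 'cV[R]_N).

Definition pairing f v : R := (f^T *m v) 0 0.

Lemma pairing_mx f v : f^T *m v = (pairing f v)%:M.
Proof. by rewrite [LHS]mx11_scalar. Qed.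

Lemma projective_class_eqP v w :
  projective_class v = projective_class w <-> exists2 a, a != 0 & v = a *: w.
Proof.
split=> [e|[a a0 ->]].
  have : projective_class v v by exists 1; rewrite ?oner_neq0 ?scale1r.
  by rewrite e.
apply/seteqP; split=> _ [b b0 ->].
  by exists (b * a); rewrite ?mulf_neq0 ?scalerA.
by exists (b / a); rewrite ?mulf_neq0 ?invr_neq0 // scalerA mulfVK.
Qed.

Lemma mulmx_projective_class M v :
  mulmx M @` projective_class v = projective_class (M *m v).
Proof.
apply/seteqP; split=> [_ [_ [a a0 ->] <-]|_ [a a0 ->]].
  by exists a; rewrite // scalemxAr.
by exists (a *: v); [exists a | rewrite scalemxAr].
Qed.

Definition pair_of v f := (projective_class v, projective_class f).

Lemma point_hyperplane_spaceP x : point_hyperplane_space x ->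
  exists v f, pairing f v != 0 /\ x = pair_of v f.
Proof.
case: x => p H /= [[/= v v0 ->] [/= f f0 ->] nH]; exists v, f; split=> //.
apply/eqP => e; apply: nH; split=> [|_ _ [a _ ->] [b _ ->]]; first by exists v.
rewrite -scalemxAr linearZ /= -scalemxAl pairing_mx e.
by rewrite -scalemx1 scale0r !scaler0.
Qed.

Lemma point_hyperplane_act_pair M v f :
  point_hyperplane_act M (pair_of v f) = pair_of (M *m v) ((invmx M)^T *m f).
Proof. by congr pair; exact: mulmx_projective_class. Qed.

Lemma invmx_mul M P : M \in unitmx -> P \in unitmx ->
  invmx (M *m P) = invmx P *m invmx M.
Proof.
move=> Mu Pu; have MPu : M *m P \in unitmx by rewrite unitmx_mul Mu.
by rewrite -[RHS](mulmxK MPu) !mulmxA mulmxKV // mulVmx // mul1mx.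
Qed.

Lemma point_hyperplane_actM M P x : M \in unitmx -> P \in unitmx ->
  point_hyperplane_act (M *m P) x =
  point_hyperplane_act M (point_hyperplane_act P x).
Proof.
move=> Mu Pu; rewrite /point_hyperplane_act /= !image_comp.
by congr pair; apply: eq_imagel => v _ /=; rewrite ?invmx_mul ?trmx_mul ?mulmxA.
Qed.

Lemma point_hyperplane_act1 x : point_hyperplane_act 1%:M x = x.
Proof.
case: x => p H; rewrite /point_hyperplane_act /= invmx1 trmx1.
by congr pair; rewrite -[RHS]image_id; apply: eq_imagel => v _; rewrite mul1mx.
Qed.

(** The matrix sought is a rank one perturbation P = 1 + (w - v) r^T of the
    identity.  It maps v to w when r^T v = 1, and its transpose maps h to f
    when r is proportional to f - h, which leaves r = (f - h) / (1 - h(v)).  It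
    is invertible when r^T w is nonzero, that is when f(w) differs from 1. *)
Lemma rank_one_transport v f w h :
  pairing f v = 1 -> pairing h w = 1 -> pairing f w != 1 ->
  pairing h v != 1 ->
  exists2 P, P \in unitmx & P *m v = w /\ P^T *m h = f.
Proof.
move=> fv hw fw1 hv1.
pose r := (1 - pairing h v)^-1 *: (f - h).
have d0 : 1 - pairing h v != 0 by rewrite subr_eq0 eq_sym.
have rE u : r^T *m u = ((1 - pairing h v)^-1 * (pairing f u - pairing h u))%:M.
  rewrite linearZ /= -scalemxAl linearB /= mulmxBl !pairing_mx.
  by rewrite -raddfB scale_scalar_mx.
have rv : r^T *m v = 1%:M by rewrite rE fv mulVf.
pose c := (1 - pairing h v)^-1 * (pairing f w - 1).
have rw : r^T *m w = c%:M by rewrite rE hw.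
have c0 : c != 0 by rewrite mulf_neq0 ?invr_neq0 // subr_eq0.
pose P := 1%:M + (w - v) *m r^T; exists P.
  (* With U = (w - v) r^T one has U^2 = (c - 1) U, so 1 - U / c is inverse to
     1 + U. *)
  have /mulmx1_unit[] // : P *m (1%:M - c^-1 *: ((w - v) *m r^T)) = 1%:M.
  rewrite mulmxBr mulmx1 -scalemxAr mulmxDl mul1mx.
  have -> : (w - v) *m r^T *m ((w - v) *m r^T) =
      (c - 1) *: ((w - v) *m r^T).
    rewrite -mulmxA [r^T *m _]mulmxA mulmxBr rw rv -raddfB /=.
    by rewrite mul_scalar_mx scalemxAr.
  rewrite -[X in X + _ *: _]scale1r -scalerDl [1 + (c - 1)]addrC subrK.
  rewrite scalerA mulVf //.
  by rewrite scale1r addrK.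
split.
  by rewrite mulmxDl mul1mx -mulmxA rv mulmx1 addrC subrK.
rewrite linearD /= trmx1 mulmxDl mul1mx trmx_mul trmxK -mulmxA.
have -> : (w - v)^T *m h = (1 - pairing h v)%:M.
  rewrite -[LHS]trmxK trmx_mul trmxK mulmxBr !pairing_mx hw -raddfB.
  by rewrite tr_scalar_mx.
by rewrite mul_mx_scalar scalerA mulfV // scale1r addrC subrK.
Qed.

(** Normalize the representatives so that both pairings are 1.  There remains
    the freedom to replace (v, f) by (s v, f / s), and a large s meets the two
    genericity conditions of [rank_one_transport]. *)
Lemma point_hyperplane_transitive v f w h :
  pairing f v != 0 -> pairing h w != 0 ->
  exists2 P, P \in unitmx &
    point_hyperplane_act P (pair_of v f) = pair_of w h.
Proof.
move=> fv hw.
have pairZl a u k : pairing (a *: u) k = a * pairing u k.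
  by rewrite /pairing linearZ /= -scalemxAl mxE.
have pairZr a u k : pairing u (a *: k) = a * pairing u k.
  by rewrite /pairing -scalemxAr mxE.
pose al := pairing f w / pairing f v; pose be := pairing h v / pairing h w.
(* The conditions exclude s = al and s = be^-1. *)
pose s := `|al| + `|be^-1| + 1.
have s0 : s != 0 by rewrite gt_eqF // ltr_pwDr // addr_ge0.
have sal : s != al.
  by rewrite gt_eqF // /s -addrA (le_lt_trans (ler_norm _)) // ltrDl ltr_pwDr.
have sbe : s != be^-1.
  rewrite gt_eqF // /s addrAC (le_lt_trans (ler_norm _)) // ltrDr.
  by rewrite ltr_pwDr.
have [P Pu [Pv Ph]] : exists2 P, P \in unitmx &
    P *m (s *: v) = w /\
    P^T *m ((pairing h w)^-1 *: h) = (s * pairing f v)^-1 *: f.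
  apply: rank_one_transport; rewrite ?pairZl ?pairZr.
  - by field; rewrite s0 fv.
  - by rewrite mulVf.
  - apply: contra sal => /eqP e; rewrite -[s]mulr1 -e /al; apply/eqP.
    by field; rewrite s0 fv.
  - apply: contra sbe => /eqP e; apply/eqP/(mulIf (x := be)).
      rewrite /be mulf_neq0 ?invr_neq0 //.
      by apply: contra_eq_neq e => ->; rewrite !mulr0 eq_sym oner_neq0.
    rewrite mulVf; last first.
      rewrite /be mulf_neq0 ?invr_neq0 //.
      by apply: contra_eq_neq e => ->; rewrite !mulr0 eq_sym oner_neq0.
    by rewrite -e /be; field.
exists P => //; rewrite point_hyperplane_act_pair; congr pair.
  apply/projective_class_eqP; exists s^-1; first exact: invr_neq0.
  by rewrite -Pv -scalemxAr scalerA mulVf // scale1r.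
apply/projective_class_eqP; exists (s * pairing f v / pairing h w).
  by rewrite !mulf_neq0 ?invr_neq0.
have fE : f = (s * pairing f v) *: (P^T *m ((pairing h w)^-1 *: h)).
  by rewrite Ph scalerA mulfV ?scale1r // mulf_neq0.
by rewrite [in LHS]fE -!scalemxAr trmx_inv mulKmx ?unitmx_tr // scalerA.
Qed.

Lemma stabilizer_conj P x g : P \in unitmx ->
  stabilizer (general_linear R N) (@point_hyperplane_act R N) x g <->
  stabilizer (general_linear R N) (@point_hyperplane_act R N)
    (point_hyperplane_act P x) (P *m g *m invmx P).
Proof.
move=> Pu; rewrite /stabilizer /general_linear /=.
have PVu : invmx P \in unitmx by rewrite unitmx_inv.
have gE : (P *m g *m invmx P \in unitmx) = (g \in unitmx).
  by rewrite !unitmx_mul Pu PVu andbT.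
rewrite gE; split=> -[gu e]; split=> //.
  by rewrite -point_hyperplane_actM ?unitmx_mul ?Pu ?gu // mulmxKV //
    point_hyperplane_actM // e.
move: e; rewrite -point_hyperplane_actM ?gE // mulmxKV // => e.
rewrite -[RHS]point_hyperplane_act1 -(mulVmx Pu) point_hyperplane_actM //.
by rewrite -e -point_hyperplane_actM ?unitmx_mul ?Pu // mulKmx.
Qed.

Lemma stabilizer_pairP v f g :
  stabilizer (general_linear R N) (@point_hyperplane_act R N) (pair_of v f) g
  <-> [/\ g \in unitmx, exists2 a, a != 0 & g *m v = a *: v &
          exists2 b, b != 0 & (invmx g)^T *m f = b *: f].
Proof.
rewrite /stabilizer /= point_hyperplane_act_pair; split.
  by case=> gu [/projective_class_eqP ? /projective_class_eqP ?].
case=> gu gv gf; split=> //.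
by congr pair; apply/projective_class_eqP.
Qed.

End PointHyperplanePairs.

(** * Stabilizers of classes of split vectors *)
Section HyperbolicPairs.
Variables (R : realType) (n : nat).
Local Notation S := (splitnum R).
Local Notation N := (n + 1)%N.
Local Notation J := (lorentz_mx R n).
Implicit Types (g : 'M[R]_N) (M : 'M[S]_N) (z : 'cV[S]_N).

(** The point and the hyperplane that correspond to the class of [z] when
    q(z, z) = -1. *)
Definition pair_of_split z := pair_of (plus_mx z) (J *m minus_mx z).

Lemma pairing_split z : qform z z = -1 ->
  pairing (J *m minus_mx z) (plus_mx z) = -1.
Proof. by move=> /qform_plus e; rewrite /pairing e mxE eqxx mulr1n. Qed.

Lemma stabilizer_unitary_classP z M :
  stabilizer (unitary_n1 R n) (@hyperbolic_act R n) (unitary_class z) M <->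
  unitary_n1 R n M /\ exists2 u : S, unitary_scalar u & M *m z = u *: z.
Proof.
split=> -[MU e]; split=> //.
  have : hyperbolic_act M (unitary_class z) (M *m z).
    exists z => //; exists 1; last by rewrite scale1r.
    by apply/split_unitary_scalarP; rewrite !rmorph1 mulr1.
  by rewrite e => -[u uU <-]; exists u.
case: e => u /split_unitary_scalarP uU Mz.
apply/seteqP; split=> w.
  case=> _ [t /split_unitary_scalarP tU <-] <-; exists (t * u).
    apply/split_unitary_scalarP.
    by rewrite !rmorphM mulrACA tU uU mulr1.
  by rewrite -scalemxAr Mz scalerA.
case=> t /split_unitary_scalarP tU <-.
have uJ : splitnum_conj u * u = 1 :> S.
  by rewrite mulrC; apply/split_unitary_scalarP.
exists ((t * splitnum_conj u) *: z).
  exists (t * splitnum_conj u) => //; apply/split_unitary_scalarP.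
  rewrite !rmorphM /= split_minus_conj split_plus_conj mulrACA tU mul1r.
  by rewrite mulrC.
by rewrite -scalemxAr Mz scalerA -mulrA uJ mulr1.
Qed.

(** An equation M z = u z splits into g z+ = u+ z+ and g^-T (J z-) = u- (J z-).
    Conversely, if g scales z+ by s and g^-T scales J z- by t, then s t = 1,
    because the pairing of J z- with z+ is invariant and nonzero: so s e+ + t e-
    is unitary. *)
Lemma stabilizer_unitary_of_real z g : qform z z = -1 -> g \in unitmx ->
  stabilizer (general_linear R N) (@point_hyperplane_act R N)
    (pair_of_split z) g <->
  stabilizer (unitary_n1 R n) (@hyperbolic_act R n) (unitary_class z)
    (unitary_of_real g).
Proof.
move=> /pairing_split zz gu; rewrite stabilizer_unitary_classP stabilizer_pairP.
set a := plus_mx z in zz *; set b := J *m minus_mx z in zz *.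
have zE : z = join_mx a (J *m b) by rewrite lorentzK join_plus_minus.
have gz : unitary_of_real g *m z = join_mx (g *m a) (J *m ((invmx g)^T *m b)).
  by rewrite zE join_mxM -!mulmxA lorentzK.
split.
  case=> _ [s s0 ga] [t t0 gb]; split; first exact: unitary_of_realP.
  have ts : t * s = 1.
    have : ((invmx g)^T *m b)^T *m (g *m a) = b^T *m a.
      by rewrite trmx_mul trmxK mulmxA mulmxKV.
    rewrite ga gb -scalemxAr linearZ /= -scalemxAl pairing_mx zz.
    move=> /(congr1 (fun X : 'M[R]_1 => X 0 0)); rewrite !mxE eqxx mulr1n.
    by rewrite mulrN1 mulrN mulrC => /oppr_inj.
  exists (split_join s t).
    by apply/split_unitary_scalarP; rewrite split_plusK split_minusK mulrC.
  by rewrite gz [in RHS]zE join_mxZ ga gb -scalemxAr.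
case=> _ [u /split_unitary_scalarP uU].
rewrite gz -(split_joinK u) [in RHS]zE join_mxZ => e.
have u0 : split_plus u != 0.
  by apply: contra_eq_neq uU => ->; rewrite mul0r eq_sym oner_neq0.
have u1 : split_minus u != 0.
  by apply: contra_eq_neq uU => ->; rewrite mulr0 eq_sym oner_neq0.
split=> //.
  exists (split_plus u) => //.
  by move/(congr1 (@plus_mx R _ _)): e; rewrite !plus_mxK.
exists (split_minus u) => //.
move/(congr1 (@minus_mx R _ _)): e; rewrite !minus_mxK => e.
by rewrite -[LHS]lorentzK e -scalemxAr lorentzK.
Qed.

End HyperbolicPairs.

(** * The isomorphism of Lie algebras *)
Section LieIsomorphism.
Variables (R : realType) (n : nat).
Local Notation S := (splitnum R).
Local Notation N := (n + 1)%N.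
Local Notation J := (lorentz_mx R n).
Variable P : 'M[R]_N.
Hypothesis Pu : P \in unitmx.
Implicit Types (g X Y : 'M[R]_N) (M : 'M[S]_N).

Definition to_unitary g : 'M[S]_N := unitary_of_real (P *m g *m invmx P).
Definition of_unitary M : 'M[R]_N := invmx P *m plus_mx M *m P.

(** The derivative of [to_unitary] at [g] in the direction [X]. *)
Definition velocity_to_unitary g X : 'M[S]_N :=
  let h := P *m g *m invmx P in
  join_mx (P *m X *m invmx P)
    (J *m (- (invmx h *m (P *m X *m invmx P) *m invmx h))^T *m J).

(** The derivative of [to_unitary] at the identity. *)
Definition lie_to_unitary X : 'M[S]_N :=
  join_mx (P *m X *m invmx P) (- (J *m (P *m X *m invmx P)^T *m J)).

Lemma conj_unitmx g : g \in unitmx -> P *m g *m invmx P \in unitmx.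
Proof. by move=> gu; rewrite !unitmx_mul Pu gu unitmx_inv. Qed.

Lemma of_unitaryK M : unitary_n1 R n M -> to_unitary (of_unitary M) = M.
Proof.
move=> MU; rewrite /to_unitary /of_unitary !mulmxA mulmxV // mul1mx mulmxK //.
exact: unitary_of_plus.
Qed.

Lemma lie_to_unitaryK X : of_unitary (lie_to_unitary X) = X.
Proof. by rewrite /of_unitary plus_mxK !mulmxA mulVmx // mul1mx mulmxKV. Qed.

Lemma of_unitary_unit M : unitary_n1 R n M -> of_unitary M \in unitmx.
Proof.
by move=> /plus_mx_unit Mu; rewrite !unitmx_mul Pu Mu unitmx_inv Pu.
Qed.

Lemma to_unitary1 : to_unitary 1%:M = 1%:M.
Proof. by rewrite /to_unitary mulmx1 mulmxV // unitary_of_real1. Qed.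

Lemma of_unitary1 : of_unitary 1%:M = 1%:M.
Proof. by rewrite /of_unitary /plus_mx map_mx1 mulmx1 mulVmx. Qed.

Lemma velocity_to_unitary1 X : velocity_to_unitary 1%:M X = lie_to_unitary X.
Proof.
rewrite /velocity_to_unitary mulmx1 mulmxV // invmx1 mul1mx mulmx1.
by rewrite linearN /= mulmxN mulNmx.
Qed.

Lemma has_velocity_to_unitary (g : R -> 'M[R]_N) t X :
  g t \in unitmx -> has_velocity (A := R^o) g t X ->
  has_velocity (fun s => to_unitary (g s)) t (velocity_to_unitary (g t) X).
Proof.
move=> gu gX; have hX := real_velocity_conj P (invmx P) gX.
apply: (has_velocity_join hX); apply: real_velocity_conj.
apply: real_velocity_tr; apply: real_velocityV hX.
exact: conj_unitmx.
Qed.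

(** The map [of_unitary] is linear, hence its own derivative. *)
Lemma has_velocity_of_unitary (g : R -> 'M[S]_N) t M :
  has_velocity g t M ->
  has_velocity (A := R^o) (fun s => of_unitary (g s)) t (of_unitary M).
Proof. by move=> gM; apply: real_velocity_conj; exact: has_velocity_plus. Qed.

(** Near 0, a curve in U(n, 1) through the identity equals its image under
    [to_unitary] after [of_unitary], so that both have the same velocity. *)
Lemma lie_algebra_unitaryK M :
  lie_algebra (unitary_n1 R n) M -> lie_to_unitary (of_unitary M) = M.
Proof.
case=> g [g0 gM gU _].
have h0 : of_unitary (g 0) \in unitmx by rewrite g0 of_unitary1 unitmx1.
have := has_velocity_to_unitary h0 (has_velocity_of_unitary gM).
rewrite g0 of_unitary1 velocity_to_unitary1 => hM.
apply: has_velocity_unique gM; apply: near_eq_has_velocity hM.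
by apply: filterS gU => s; exact: of_unitaryK.
Qed.

Lemma lie_algebra_to_unitary (G : set 'M[R^o]_N) (H : set 'M[S]_N) X :
  (forall g, G g -> g \in unitmx) -> (forall g, G g -> H (to_unitary g)) ->
  G 1%:M -> lie_algebra G X -> lie_algebra H (lie_to_unitary X).
Proof.
move=> Gu GH G1 GX; rewrite -velocity_to_unitary1.
apply: (lie_algebra_map (F := to_unitary) _ _ _ _ GX) => //.
  exact: to_unitary1.
by move=> g t Y /Gu; exact: has_velocity_to_unitary.
Qed.

Lemma lie_algebra_of_unitary (G : set 'M[R^o]_N) (H : set 'M[S]_N) M :
  (forall h, H h -> G (of_unitary h)) ->
  H 1%:M -> lie_algebra H M -> lie_algebra G (of_unitary M).
Proof.
move=> HG H1 HM.
apply: (lie_algebra_map (F := of_unitary) (dF := fun _ => of_unitary)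
  _ _ _ _ HM) => //.
  exact: of_unitary1.
by move=> g t Y _; exact: has_velocity_of_unitary.
Qed.

Lemma lie_to_unitaryD X Y :
  lie_to_unitary (X + Y) = lie_to_unitary X + lie_to_unitary Y.
Proof.
rewrite /lie_to_unitary join_mxD mulmxDr mulmxDl; congr join_mx.
by rewrite linearD /= mulmxDr mulmxDl opprD.
Qed.

Lemma lie_to_unitaryZ (a : R) X :
  lie_to_unitary (a *: X) = real_scale a (lie_to_unitary X).
Proof.
rewrite /real_scale split_scalar join_mxZ /lie_to_unitary -scalemxAr -scalemxAl.
by rewrite linearZ /= -scalemxAr -scalemxAl scalerN.
Qed.

Lemma lie_to_unitary_bracket X Y :
  lie_to_unitary (X *m Y - Y *m X) =
  lie_bracket (lie_to_unitary X) (lie_to_unitary Y).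
Proof.
have conjM U V : P *m (U *m V) *m invmx P =
    (P *m U *m invmx P) *m (P *m V *m invmx P).
  by rewrite !mulmxA mulmxKV.
rewrite /lie_bracket !join_mxM join_mxN join_mxD; congr join_mx.
  by rewrite mulmxBr mulmxBl !conjM.
rewrite mulmxBr mulmxBl !conjM linearB /= !trmx_mul -/J.
set U := (invmx P)^T *m _; set V := (invmx P)^T *m _.
rewrite !mulNmx !mulmxN !opprK !mulmxA !lorentzKr.
by rewrite mulmxBr mulmxBl opprB !mulmxA.
Qed.

End LieIsomorphism.

Theorem mainTheorem11 (R : realType) (n : nat)
    (x : set 'cV[R]_(n + 1) * set 'cV[R]_(n + 1))
    (hx : point_hyperplane_space x)
    (y : set 'cV[splitnum R]_(n + 1))
    (hy : hyperbolic_space y) :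
  locally_isomorphic
    (general_linear R (n + 1))
    (stabilizer (general_linear R (n + 1)) (@point_hyperplane_act R (n + 1)) x)
    (unitary_n1 R n)
    (stabilizer (unitary_n1 R n) (@hyperbolic_act R n) y).
Proof.
case: hy => z zz ->.
have [v [f [fv ->]]] := point_hyperplane_spaceP hx.
have [|P Pu Px] := point_hyperplane_transitive (w := plus_mx z)
  (h := lorentz_mx R n *m minus_mx z) fv.
  by rewrite pairing_split // oppr_eq0 oner_neq0.
have GLU g : general_linear R (n + 1) g -> unitary_n1 R n (to_unitary P g).
  by move=> gu; apply: unitary_of_realP; exact: conj_unitmx.
have stabE g : g \in unitmx ->
    stabilizer (general_linear R (n + 1)) (@point_hyperplane_act R (n + 1))
      (pair_of v f) g <->
    stabilizer (unitary_n1 R n) (@hyperbolic_act R n) (unitary_class z)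
      (to_unitary P g).
  move=> gu; rewrite (stabilizer_conj _ _ Pu) Px.
  by apply: stabilizer_unitary_of_real => //; exact: conj_unitmx.
have GL1 : general_linear R (n + 1) 1%:M by exact: unitmx1.
have U1 : unitary_n1 R n 1%:M by rewrite -(to_unitary1 Pu); exact: GLU.
have stab1 : stabilizer (general_linear R (n + 1))
    (@point_hyperplane_act R (n + 1)) (pair_of v f) 1%:M.
  by split=> //; exact: point_hyperplane_act1.
exists (lie_to_unitary P); split; first split.
- split=> [X|X Y _ _ e|M HM].
  + exact: lie_algebra_to_unitary.
  + by rewrite -(lie_to_unitaryK Pu X) e lie_to_unitaryK.
  + exists (of_unitary P M); last exact: lie_algebra_unitaryK.
    apply: lie_algebra_of_unitary HM => // h; exact: of_unitary_unit.
- by move=> X Y _ _; exact: lie_to_unitaryD.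
- move=> X _ a; rewrite -lie_to_unitaryZ; congr lie_to_unitary.
  by rewrite /real_scale [a%:A]mulr1.
- by move=> X Y _ _; exact: lie_to_unitary_bracket.
apply/seteqP; split=> [_ [X KX <-]|M CM].
  apply: (lie_algebra_to_unitary Pu _ _ stab1 KX) => [g []|g gK] //.
  by apply/stabE => //; case: gK.
exists (of_unitary P M).
  apply: lie_algebra_of_unitary CM => //.
    move=> h [hU he]; apply/stabE; first exact: of_unitary_unit.
    by rewrite of_unitaryK.
  by rewrite -(to_unitary1 Pu); apply/stabE => //; exact: unitmx1.
apply: lie_algebra_unitaryK => //.
case: CM => g [g0 gM gC gD]; exists g; split=> //.
by apply: filterS gC => s [].
Qed.
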